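(* Let $P$ and $\mathcal{J}$ be as defined in the context. Let $M$ be a finite dimensional $\mathcal{J}$-module, and define a $\mathbf{k}$-linear map $p$ on $M$ by $p(v)=yv$ for all $v\in M$. Then $(M,p)$ (with $M$ regarded as an $x\mathbf{k}[x]$-module through the action of $x$) is an $(x\mathbf{k}[x],P)$-module. Conversely, if $(M,p)$ is a finite dimensional $(x\mathbf{k}[x],P)$-module and we define $yv=p(v)$ for all $v\in M$ (with $x$ acting by the given $x\mathbf{k}[x]$-module structure), then $M$ is a $\mathcal{J}$-module.
   Context: $\mathbf{k}$ is an algebraically closed field of characteristic zero. $x\mathbf{k}[x]=\{xf\mid f\in\mathbf{k}[x]\}$ is regarded as a (non-unital) $\mathbf{k}$-algebra, and $P:x\mathbf{k}[x]\to x\mathbf{k}[x]$ is the $\mathbf{k}$-linear map with $P(x^n)=-x^n$ for all $n\ge1$, a Rota-Baxter operator of weight $1$. An $x\mathbf{k}[x]$-module is a $\mathbf{k}$-vector space with a $\mathbf{k}$-bilinear associative action of $x\mathbf{k}[x]$; it amounts to a vector space with the linear map $v\mapsto xv$. An $(x\mathbf{k}[x],P)$-module is a pair $(M,p)$ where $M$ is an $x\mathbf{k}[x]$-module and $p:M\to M$ is $\mathbf{k}$-linear with $P(f)p(v)=p(P(f)v)+p(fp(v))+p(fv)$ for all $f\in x\mathbf{k}[x]$, $v\in M$. All such modules are assumed finite dimensional over $\mathbf{k}$. $\mathbf{k}\langle x,y\rangle$ is the noncommutative (unital) polynomial algebra in $x,y$; $I_P$ is its two-sided ideal generated by $\{P(f)y-yP(f)-yfy-yf\mid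 f\in x\mathbf{k}[x]\}$; $\mathcal{J}=\mathbf{k}\langle x,y\rangle/I_P$. $\mathcal{J}$-modules are left unital modules. *)

(* Defs.v *)
From HB Require Import structures.
From mathcomp Require Import all_boot all_order all_algebra.
From mathcomp Require Import boolp.
From mathcomp Require Import finmap.
From mathcomp.multinomials Require Import monalg.

Set Implicit Arguments.
Unset Strict Implicit.
Unset Printing Implicit Defensive.

Import GRing.Theory.
Local Open Scope ring_scope.
Local Open Scope quotient_scope.

Section NonunitalPolynomials.
Variable k : fieldType.

Definition xdvd : {pred {poly k}} := fun f => 'X %| f.

Fact xdvd_submod : submod_closed xdvd.
Proof.
split=> [|a u v]; rewrite !unfold_in ?dvdp0 // => uX vX.
by apply: dvdp_add => //; rewrite -mul_polyC dvdp_mull.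
Qed.

HB.instance Definition _ :=
  GRing.isSubmodClosed.Build k {poly k} xdvd xdvd_submod.

(* The non-unital algebra x k[x]; its product is [xmul]. *)
Record xpoly := XPoly { xpoly_val :> {poly k}; _ : xpoly_val \in xdvd }.

HB.instance Definition _ := [isSub for xpoly_val].
HB.instance Definition _ := [Choice of xpoly by <:].
HB.instance Definition _ := [SubChoice_isSubLmodule of xpoly by <:].

Fact xmul_subproof (f g : xpoly) : (f : {poly k}) * g \in xdvd.
Proof. by case: f g => [f fX] [g gX]; rewrite unfold_in /= dvdp_mulr. Qed.
Definition xmul (f g : xpoly) : xpoly := XPoly (xmul_subproof f g).

Fact xpow_subproof n : 'X^(n.+1) \in xdvd.
Proof. by rewrite unfold_in exprS dvdp_mulr. Qed.
(* Beware of the shift: [xpow n] is x^(n+1), so that [xpow] runs through the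
   monomial basis of x k[x]. *)
Definition xpow n : xpoly := XPoly (xpow_subproof n).

End NonunitalPolynomials.

Section Modules.
Variable k : fieldType.

Record assoc_action (A V : lmodType k) (mul : A -> A -> A) (s : A -> V -> V) :
    Prop := AssocAction {
  action_linearl : forall v, linear (s^~ v);
  action_linearr : forall a, linear (s a);
  actionM : forall a b v, s (mul a b) v = s a (s b v)
}.

(* Left unital modules over a unital k-algebra A, presented as A-actions on a
   given k-vector space.  This is the same thing as an [lmodType A] whose
   underlying k-vector space is V: see [algmod_lmod] and [lmod_algmod]. *)
Record unital_module (A : algType k) (V : lmodType k) (s : A -> V -> V) :
    Prop := UnitalModule {
  unital_module_action : assoc_action *%R s;
  unital_module1 : forall v, s 1 v = v
}.

Definition xpoly_module (V : lmodType k) (act : xpoly k -> V -> V) :=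
  assoc_action (@xmul k) act.

Record RB_module (P : xpoly k -> xpoly k) (V : lmodType k)
    (act : xpoly k -> V -> V) (p : V -> V) : Prop := RBModule {
  RB_module_action : xpoly_module act;
  RB_module_linear : linear p;
  RB_moduleE : forall f v,
    act (P f) (p v) = p (act (P f) v) + p (act f (p v)) + p (act f v)
}.

Section ToLmodType.
Variables (A : algType k) (V : lmodType k) (s : A -> V -> V).
Hypothesis sV : unital_module s.

Definition algmod of unital_module s : Type := V.
HB.instance Definition _ := GRing.Zmodule.on (algmod sV).

Fact algmod_scaleA a b v : s a (s b v) = s (a * b) v.
Proof. by rewrite (actionM (unital_module_action sV)). Qed.
Fact algmod_scaleDr : right_distributive s +%R.
Proof.
move=> a u v.
by have := action_linearr (unital_module_action sV) a 1 u v; rewrite !scale1r.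
Qed.
Fact algmod_scaleDl v : {morph s^~ v : a b / a + b}.
Proof.
move=> a b.
by have := action_linearl (unital_module_action sV) v 1 a b; rewrite !scale1r.
Qed.

HB.instance Definition _ := GRing.Zmodule_isLmodule.Build A (algmod sV)
  algmod_scaleA (unital_module1 sV) algmod_scaleDr algmod_scaleDl.

Definition algmod_lmod : lmodType A := algmod sV.

Lemma algmod_lmodE (a : A) (v : V) : a *: (v : algmod_lmod) = s a v.
Proof. by []. Qed.
End ToLmodType.

Section FromLmodType.
Variables (A : algType k) (M : lmodType A).

Definition restr : Type := M.
HB.instance Definition _ := GRing.Zmodule.on restr.

Definition restr_scale (c : k) (v : restr) : restr := (c%:A : A) *: (v : M).
Fact restr_scaleA a b v : restr_scale a (restr_scale b v) = restr_scale (a * b) v.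
Proof. by rewrite /restr_scale scalerA -scalerAl mul1r scalerA. Qed.
Fact restr_scale1 : left_id 1 restr_scale.
Proof. by move=> v; rewrite /restr_scale !scale1r. Qed.
Fact restr_scaleDr : right_distributive restr_scale +%R.
Proof. by move=> a u v; rewrite /restr_scale scalerDr. Qed.
Fact restr_scaleDl v : {morph restr_scale^~ v : a b / a + b}.
Proof. by move=> a b; rewrite /restr_scale !scalerDl. Qed.

HB.instance Definition _ := GRing.Zmodule_isLmodule.Build k restr
  restr_scaleA restr_scale1 restr_scaleDr restr_scaleDl.

Lemma lmod_algmod :
  unital_module (fun (a : A) (v : restr) => (a *: (v : M) : restr)).
Proof.
have ZE (c : k) (v : restr) : c *: v = (c%:A : A) *: (v : M) by [].
split; last by move=> v; rewrite scale1r.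
split=> [v c a b|a c u v|a b v].
- by rewrite ZE scalerDl scalerA -scalerAl mul1r.
- by rewrite !ZE scalerDr !scalerA -scalerAl -scalerAr mul1r mulr1.
- by rewrite scalerA.
Qed.
End FromLmodType.

End Modules.

Section FreeAlgebra.
Variable k : fieldType.

Fact malg_scalerAr (K : monomType) (c : k) (u v : {malg k[K]}) :
  c *: (u * v) = u * (c *: v).
Proof.
apply/malgP=> m; rewrite mcoeffZ mcoeffMl.
rewrite (@mcoeffMlw K k (msupp u) (msupp v) u (c *: v) m) //; last first.
  exact: msuppZ_le.
rewrite mulr_sumr; apply: eq_bigr => m1 _; rewrite mulr_sumr.
by apply: eq_bigr => m2 _; rewrite mcoeffZ mulrnAr mulrCA.
Qed.

(* The free algebra k<x,y>: the monoid algebra of words in two letters. *)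
Definition freealg : Type := {malg k[{fmonom 'I_2}]}.
HB.instance Definition _ := GRing.Lalgebra.on freealg.
HB.instance Definition _ :=
  GRing.Lalgebra_isAlgebra.Build k freealg
  (@malg_scalerAr {fmonom 'I_2}).

Definition freeX : freealg := << @fmu 'I_2 ord0 >>.
Definition freeY : freealg := << @fmu 'I_2 ord_max >>.

End FreeAlgebra.
Arguments freeX {k}.
Arguments freeY {k}.

Inductive two_sided_ideal (R : pzRingType) (S : R -> Prop) : R -> Prop :=
| Ideal_gen a of S a : two_sided_ideal S a
| Ideal0 : two_sided_ideal S 0
| IdealD a b of two_sided_ideal S a & two_sided_ideal S b :
    two_sided_ideal S (a + b)
| IdealMl a b of two_sided_ideal S b : two_sided_ideal S (a * b)
| IdealMr a b of two_sided_ideal S a : two_sided_ideal S (a * b).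

Section AlgebraQuotient.
Variables (k : fieldType) (R : algType k) (S : R -> Prop).

Definition ideal_pred : {pred R} := fun u => `[< two_sided_ideal S u >].

Lemma idealP u : reflect (two_sided_ideal S u) (u \in ideal_pred).
Proof. exact: asboolP. Qed.

Fact ideal_zmod_closed : zmod_closed ideal_pred.
Proof.
split=> [|u v /idealP Iu /idealP Iv]; apply/idealP; first exact: Ideal0.
by apply: IdealD => //; rewrite -mulN1r; apply: IdealMl.
Qed.
HB.instance Definition _ :=
  GRing.isZmodClosed.Build _ ideal_pred ideal_zmod_closed.

Lemma ideal_mull u v : v \in ideal_pred -> u * v \in ideal_pred.
Proof. by move=> /idealP Iv; apply/idealP; apply: IdealMl. Qed.
Lemma ideal_mulr u v : u \in ideal_pred -> u * v \in ideal_pred.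
Proof. by move=> /idealP Iv; apply/idealP; apply: IdealMr. Qed.

(* The quotient of R by the two-sided ideal generated by S.  MathComp provides
   the quotient Z-module; the algebra structure has to be added, as its ring
   quotients are only available for commutative rings. *)
Definition algquot of ~ two_sided_ideal S 1 : Type := Quotient.quot ideal_pred.

Hypothesis properS : ~ two_sided_ideal S 1.
Local Notation Q := (algquot properS).
HB.instance Definition _ := Choice.on Q.
HB.instance Definition _ := GRing.Zmodule.on Q.
HB.instance Definition _ := EqQuotient.on Q.
HB.instance Definition _ := ZmodQuotient.on Q.

Lemma algquot_eqP (u v : R) :
  reflect (\pi_Q u = \pi_Q v) (u - v \in ideal_pred).
Proof. by rewrite Quotient.idealrBE; apply: eqP. Qed.

Definition algquot_one : Q := \pi_Q 1.
Definition algquot_mul := lift_op2 Q *%R.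
Definition algquot_scale (c : k) := lift_op1 Q ( *:%R c).

Lemma algquot_repr (u : R) : repr (\pi_Q u) - u \in ideal_pred.
Proof. by apply/algquot_eqP; rewrite reprK. Qed.

Lemma algquot_piM (u v : R) :
  \pi_Q (u * v) = algquot_mul (\pi_Q u) (\pi_Q v).
Proof.
symmetry; unlock algquot_mul; apply/algquot_eqP.
set u' := repr _; set v' := repr _.
have -> : u' * v' - u * v = u' * (v' - v) + (u' - u) * v.
  by rewrite mulrBr mulrBl addrA subrK.
by apply: rpredD; [apply: ideal_mull | apply: ideal_mulr]; apply: algquot_repr.
Qed.

Lemma algquot_piZ c (u : R) :
  \pi_Q (c *: u) = algquot_scale c (\pi_Q u).
Proof.
symmetry; unlock algquot_scale; apply/algquot_eqP; rewrite -scalerBr -mulr_algl ideal_mull //.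
exact: algquot_repr.
Qed.

Lemma algquot_piD (u v : R) :
  \pi_Q (u + v) = (\pi_Q u : Q) + \pi_Q v.
Proof. exact: raddfD. Qed.

Fact algquot_mulA : associative algquot_mul.
Proof.
elim/quotW=> a; elim/quotW=> b; elim/quotW=> c.
by rewrite -!algquot_piM mulrA.
Qed.
Fact algquot_mul1 : left_id algquot_one algquot_mul.
Proof. by elim/quotW=> a; rewrite -algquot_piM mul1r. Qed.
Fact algquot_mulr1 : right_id algquot_one algquot_mul.
Proof. by elim/quotW=> a; rewrite -algquot_piM mulr1. Qed.
Fact algquot_mulDl : left_distributive algquot_mul +%R.
Proof.
elim/quotW=> a; elim/quotW=> b; elim/quotW=> c.
by rewrite -algquot_piD -!algquot_piM mulrDl algquot_piD.
Qed.
Fact algquot_mulDr : right_distributive algquot_mul +%R.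
Proof.
elim/quotW=> a; elim/quotW=> b; elim/quotW=> c.
by rewrite -algquot_piD -!algquot_piM mulrDr algquot_piD.
Qed.
Fact algquot_one_neq0 : algquot_one != 0.
Proof.
apply/eqP=> one0; apply/properS/idealP; rewrite -[1]subr0.
by apply/algquot_eqP; rewrite -/algquot_one one0 raddf0.
Qed.
HB.instance Definition _ := GRing.Zmodule_isNzRing.Build Q
  algquot_mulA algquot_mul1 algquot_mulr1 algquot_mulDl algquot_mulDr algquot_one_neq0.

Fact algquot_scaleA a b v :
  algquot_scale a (algquot_scale b v) = algquot_scale (a * b) v.
Proof. by elim/quotW: v => v; rewrite -!algquot_piZ scalerA. Qed.
Fact algquot_scale1 : left_id 1 algquot_scale.
Proof. by elim/quotW=> v; rewrite -algquot_piZ scale1r. Qed.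
Fact algquot_scaleDr : right_distributive algquot_scale +%R.
Proof.
move=> c; elim/quotW=> u; elim/quotW=> v.
by rewrite -algquot_piD -!algquot_piZ scalerDr algquot_piD.
Qed.
Fact algquot_scaleDl v : {morph algquot_scale^~ v : a b / a + b}.
Proof.
by elim/quotW: v => v a b; rewrite -!algquot_piZ scalerDl algquot_piD.
Qed.
HB.instance Definition _ := GRing.Zmodule_isLmodule.Build k Q
  algquot_scaleA algquot_scale1 algquot_scaleDr algquot_scaleDl.

Fact algquot_scaleAl (c : k) (u v : Q) : c *: (u * v) = (c *: u) * v.
Proof.
elim/quotW: u => u; elim/quotW: v => v.
rewrite /GRing.mul /GRing.scale /=.
by rewrite -algquot_piM -!algquot_piZ -algquot_piM scalerAl.
Qed.
HB.instance Definition _ :=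
  GRing.Lmodule_isLalgebra.Build k Q algquot_scaleAl.

Fact algquot_scaleAr (c : k) (u v : Q) : c *: (u * v) = u * (c *: v).
Proof.
elim/quotW: u => u; elim/quotW: v => v.
rewrite /GRing.mul /GRing.scale /=.
by rewrite -algquot_piM -!algquot_piZ -algquot_piM scalerAr.
Qed.
HB.instance Definition _ :=
  GRing.Lalgebra_isAlgebra.Build k Q algquot_scaleAr.

Definition algquot_pi (u : R) : Q := \pi_Q u.

Fact algquot_pi_linear : linear algquot_pi.
Proof. by move=> c u v; rewrite /algquot_pi algquot_piD algquot_piZ. Qed.
Fact algquot_pi_monoid_morphism : monoid_morphism algquot_pi.
Proof. by split=> // u v; rewrite /algquot_pi algquot_piM. Qed.
HB.instance Definition _ :=
  GRing.isLinear.Build k R Q *:%R algquot_pi algquot_pi_linear.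
HB.instance Definition _ :=
  GRing.isMonoidMorphism.Build R Q algquot_pi algquot_pi_monoid_morphism.

End AlgebraQuotient.

Section RBAlgebra.
Variables (k : fieldType) (P : {linear xpoly k -> xpoly k}).

Definition RB_relator (f : xpoly k) : freealg k :=
  let ev (g : xpoly k) := horner_alg freeX (g : {poly k}) in
  ev (P f) * freeY - freeY * ev (P f) - freeY * ev f * freeY - freeY * ev f.

Definition RB_relators (u : freealg k) : Prop := exists f, u = RB_relator f.

Fact RB_relator_ker (R : pzRingType) (e : R -> k) (g h y : R) :
    {morph e : u v / u * v} -> {morph e : u v / u + v} ->
    {morph e : u / - u} -> e y = 0 ->
  e (g * y - y * g - y * h * y - y * h) = 0.
Proof.
move=> eM eD eN ey.
by rewrite !eD !eN !eM ey !(mul0r, mulr0) !oppr0 !addr0.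
Qed.

Fact RB_proper : ~ two_sided_ideal RB_relators 1.
Proof.
have [e [e1 eM eD eN eY]] : exists e : freealg k -> k,
  [/\ e 1 = 1, {morph e : u v / u * v}, {morph e : u v / u + v},
      {morph e : u / - u} & e freeY = 0].
  exists (@mcoeff {fmonom 'I_2} k mone); split.
  - by rewrite mcoeff1 eqxx.
  - by move=> u v; apply: (rmorphM (@mcoeff {fmonom 'I_2} k mone)).
  - by move=> u v; rewrite mcoeffD.
  - by move=> u; rewrite mcoeffN.
  - by rewrite mcoeffU1 -val_eqE /= fmuE /mone /= fmoneE.
have e0 : e 0 = 0 by rewrite -[in LHS](mul0r freeY) eM eY mulr0.
suff eI u : two_sided_ideal RB_relators u -> e u = 0.
  by move=> /eI /eqP; rewrite e1 oner_eq0.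
elim=> [_ [f ->]||a b _ ea _ eb|a b _ eb|a b _ ea] //.
- exact: RB_relator_ker.
- by rewrite eD ea eb addr0.
- by rewrite eM eb mulr0.
- by rewrite eM ea mul0r.
Qed.

(* The algebra k<x,y>/I_P. *)
Definition Jalg : Type := algquot RB_proper.
HB.instance Definition _ := GRing.Algebra.on Jalg.

Definition Jpi : freealg k -> Jalg := algquot_pi RB_proper.
HB.instance Definition _ := GRing.LRMorphism.on Jpi.

Definition jX : Jalg := Jpi freeX.
Definition jY : Jalg := Jpi freeY.

(* The x k[x]-module underlying a J-module: f acts as f(x). *)
Definition through_x (V : lmodType k) (s : Jalg -> V -> V)
    (f : xpoly k) (v : V) : V := s (horner_alg jX (f : {poly k})) v.

End RBAlgebra.

(* Main.v *)
Require Import Defs.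
From HB Require Import structures.
From mathcomp Require Import all_boot all_algebra.
From mathcomp Require Import finmap.
From mathcomp.multinomials Require Import monalg.

Set Implicit Arguments.
Unset Strict Implicit.
Unset Printing Implicit Defensive.

Import GRing.Theory.
Local Open Scope ring_scope.

(* A J-module structure on M is the same thing as an action of the free algebra
   on M that kills the ideal I_P, and the action of the generator of I_P
   attached to f vanishes exactly when the Rota-Baxter identity holds at f.
   Moreover x k[x] is spanned by the powers of x, so its action is determined
   by that of x. *)

(** * Consequences of linearity for unbundled functions *)

Section LinearFun.
Variables (k : fieldType) (U V : lmodType k) (f : U -> V) (fL : linear f).

Let F : {linear U -> V} := HB.pack f (GRing.isLinear.Build k U V *:%R f fL).

Lemma flinear0 : f 0 = 0. Proof. exact: (linear0 F). Qed.

Lemma flinearD : {morph f : u v / u + v}. Proof. exact: (linearD F). Qed.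

Lemma flinearB : {morph f : u v / u - v}. Proof. exact: (linearB F). Qed.

Lemma flinearZ c : {morph f : u / c *: u}. Proof. exact: (linearZ_LR F). Qed.

Lemma flinear_sum I (r : seq I) (G : I -> U) :
  f (\sum_(i <- r) G i) = \sum_(i <- r) f (G i).
Proof. exact: (linear_sum F). Qed.

End LinearFun.

(** * Extending a monoid action linearly to the monoid algebra *)

Section MalgAction.
Variables (k : fieldType) (K : monomType) (V : lmodType k) (h : K -> V -> V).

Definition malg_act (u : {malg k[K]}) (v : V) : V :=
  \sum_(m <- msupp u) mcoeff m u *: h m v.

(** Terms outside the support have coefficient zero; enlarging the index set lets sums with
    different supports be compared. *)
Lemma malg_actEw (d : {fset K}) u v : (msupp u `<=` d)%fset ->
  malg_act u v = \sum_(m <- d) mcoeff m u *: h m v.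
Proof.
move=> le; rewrite [LHS](big_fset_incl _ le) => //= m _ /mcoeff_outdom ->.
by rewrite scale0r.
Qed.

Lemma malg_actU c m v : malg_act (mkmalgU m c) v = c *: h m v.
Proof. by rewrite (malg_actEw _ msuppU_le) big_seq_fset1 mcoeffUU. Qed.

Lemma malg_act_linearl v : linear (malg_act^~ v).
Proof.
move=> c u1 u2; set d := (msupp u1 `|` msupp u2)%fset.
have d1 : (msupp u1 `<=` d)%fset by apply: fsubsetUl.
have d2 : (msupp u2 `<=` d)%fset by apply: fsubsetUr.
have d3 : (msupp (c *: u1 + u2) `<=` d)%fset.
  apply: fsubset_trans (msuppD_le _ _) _; apply: fsetSU; exact: msuppZ_le.
rewrite (malg_actEw _ d1) (malg_actEw _ d2) (malg_actEw _ d3).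
rewrite scaler_sumr -big_split /=; apply: eq_bigr => m _.
by rewrite mcoeffD mcoeffZ scalerDl scalerA.
Qed.

Hypothesis h_linear : forall m, linear (h m).
Lemma malg_act_linearr u : linear (malg_act u).
Proof.
move=> c v1 v2; rewrite /malg_act scaler_sumr -big_split /=.
by apply: eq_bigr => m _; rewrite h_linear scalerDr !scalerA mulrC.
Qed.

Hypothesis h1 : forall v, h mone v = v.
Hypothesis hM : forall m1 m2 v, h (mmul m1 m2) v = h m1 (h m2 v).

Lemma malg_act1 v : malg_act 1 v = v.
Proof. by rewrite malg_actU h1 scale1r. Qed.

(** Both sides expand to double sums over the two supports, which agree termwise by [hM]. *)
Lemma malg_actM u1 u2 v : malg_act (u1 * u2) v = malg_act u1 (malg_act u2 v).
Proof.
rewrite malgME (flinear_sum (malg_act_linearl v)) /=.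
apply: eq_bigr => m1 _.
rewrite (flinear_sum (malg_act_linearl v)) /=.
rewrite (flinear_sum (h_linear m1)) scaler_sumr /=.
apply: eq_bigr => m2 _.
by rewrite malg_actU (flinearZ (h_linear m1)) /= scalerA hM.
Qed.

End MalgAction.

(** * Words acting letter by letter *)

Section WordAction.
Variables (k : fieldType) (I : choiceType) (V : lmodType k).
Variable (a : I -> V -> V).

(** With [foldr] the rightmost letter acts first, so that concatenation becomes composition, as a
    left action requires. *)
Definition word_act (w : {fmonom I}) (v : V) : V := foldr a v w.

Lemma word_act_linear : (forall i, linear (a i)) -> forall w, linear (word_act w).
Proof.
by move=> aL [w] c u v; rewrite /word_act /=; elim: w => //= i w ->; apply: aL.
Qed.

Lemma word_act1 v : word_act mone v = v.
Proof. by rewrite /word_act fm1. Qed.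

Lemma word_actU i v : word_act (fmu i) v = a i v.
Proof. by rewrite /word_act fmU. Qed.

Lemma word_actM w1 w2 v : word_act (mmul w1 w2) v = word_act w1 (word_act w2 v).
Proof. by rewrite /word_act fmM foldr_cat. Qed.

End WordAction.

(** * Modules over the free algebra *)

Section FreeAction.
Variables (k : fieldType) (V : lmodType k) (X Y : V -> V).
Hypotheses (XL : linear X) (YL : linear Y).

Let a (i : 'I_2) : V -> V := if i == ord0 then X else Y.

Definition free_act (u : freealg k) (v : V) : V := malg_act (word_act a) u v.

Let aL i : linear (a i). Proof. by rewrite /a; case: ifP. Qed.

Lemma free_act_unital : unital_module free_act.
Proof.
split; last by apply: malg_act1; apply: word_act1.
split=> [v|u|u1 u2 v].
- exact: malg_act_linearl.
- by apply: malg_act_linearr; apply: word_act_linear.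
- by apply: malg_actM; [apply: word_act_linear | apply: word_actM].
Qed.

Lemma free_actX v : free_act freeX v = X v.
Proof. by rewrite /free_act malg_actU scale1r word_actU. Qed.

Lemma free_actY v : free_act freeY v = Y v.
Proof. by rewrite /free_act malg_actU scale1r word_actU. Qed.

(** Universal property of the free algebra, applied to endomorphisms of [V]. *)
Lemma free_moduleP : exists s : freealg k -> V -> V,
  [/\ unital_module s, s freeX =1 X & s freeY =1 Y].
Proof.
exists free_act.
by split; [exact: free_act_unital | exact: free_actX | exact: free_actY].
Qed.

End FreeAction.

(** * Ideals, polynomials and relators acting on a unital module *)

Section UnitalModuleTheory.
Variables (k : fieldType) (A : algType k) (V : lmodType k) (s : A -> V -> V).
Hypothesis sV : unital_module s.

Lemma unital_moduleM a b v : s (a * b) v = s a (s b v).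
Proof. exact: actionM (unital_module_action sV) a b v. Qed.

Lemma unital_module_linearl v : linear (s^~ v).
Proof. exact: action_linearl (unital_module_action sV) v. Qed.

Lemma unital_module_linearr a : linear (s a).
Proof. exact: action_linearr (unital_module_action sV) a. Qed.

Lemma unital_module0l v : s 0 v = 0.
Proof. exact: (flinear0 (unital_module_linearl v)). Qed.

Lemma unital_moduleDl v : {morph s^~ v : a b / a + b}.
Proof. exact: (flinearD (unital_module_linearl v)). Qed.

Lemma unital_moduleBl v : {morph s^~ v : a b / a - b}.
Proof. exact: (flinearB (unital_module_linearl v)). Qed.

Lemma unital_module0r a : s a 0 = 0.
Proof. exact: (flinear0 (unital_module_linearr a)). Qed.

Lemma horner_alg_xpoly_module x :
  xpoly_module (fun f v => s (horner_alg x (f : {poly k})) v).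
Proof.
split=> [v c f g|f|f g v]; last by rewrite /= rmorphM unital_moduleM.
  by rewrite /= !linearP /= mulr_algl unital_module_linearl.
exact: unital_module_linearr.
Qed.

(** The annihilator of a module is a two-sided ideal. *)
Lemma ideal_act_eq0 (S : A -> Prop) :
    (forall u, S u -> forall v, s u v = 0) ->
  forall u, two_sided_ideal S u -> forall v, s u v = 0.
Proof.
move=> S0 u; elim=> {u} [u /S0 //||u1 u2 _ IH1 _ IH2|u1 u2 _ IH|u1 u2 _ IH] v.
- exact: unital_module0l.
- by rewrite unital_moduleDl IH1 IH2 addr0.
- by rewrite unital_moduleM IH unital_module0r.
- by rewrite unital_moduleM IH.
Qed.

(** For [g] = [P f] and [h] = [f] the right-hand side is the defect of the Rota-Baxter identity. The
    algebra is arbitrary so that this serves both the free algebra and its quotient. *)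
Lemma horner_relator_act (act : xpoly k -> V -> V) (p : V -> V) x y :
    (forall (f : xpoly k) v, s (horner_alg x (f : {poly k})) v = act f v) ->
    s y =1 p ->
  forall (g h : xpoly k) v (G := horner_alg x (g : {poly k}))
    (H := horner_alg x (h : {poly k})),
  s (G * y - y * G - y * H * y - y * H) v =
  act g (p v) - (p (act g v) + p (act h (p v)) + p (act h v)).
Proof.
move=> sx sy g h v G H.
by rewrite !unital_moduleBl !unital_moduleM !sx !sy !opprD !addrA.
Qed.

(* Writing f = q * 'X and inducting on q by Horner's scheme avoids decomposing
   f into monomials. *)
Lemma xpoly_module_horner (act : xpoly k -> V -> V) x :
    xpoly_module act -> (forall v, s x v = act (xpow k 0) v) ->
  forall (f : xpoly k) v, s (horner_alg x (f : {poly k})) v = act f v.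
Proof.
move=> act_xk sx [f fX] v; have /dvdpP[q fE] := fX; subst f.
elim/poly_ind: q fX v => [|q c IHq] fX v.
  rewrite [in RHS](_ : XPoly fX = 0); last by apply: val_inj; rewrite /= mul0r.
  rewrite /= mul0r raddf0 unital_module0l.
  by rewrite (flinear0 (action_linearl act_xk v)).
have qX : q * 'X \in @xdvd k by rewrite unfold_in dvdp_mull.
(* Since [xpow k 0] is x itself, this is (qx + c)x = cx + (qx)x; the last product stays inside x
   k[x], where associativity of [act] applies. *)
have fE : XPoly fX = c *: xpow k 0 + xmul (XPoly qX) (xpow k 0).
  by apply: val_inj; rewrite /= expr1 mulrDl mul_polyC addrC.
rewrite [in RHS]fE (action_linearl act_xk) (actionM act_xk) -IHq.
rewrite -!sx -unital_moduleM.
rewrite -unital_module_linearl; congr (s _ v).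
by rewrite /= mulrDl rmorphD !rmorphM /= horner_algX horner_algC addrC mulr_algl.
Qed.

End UnitalModuleTheory.

(** * Descent of a module structure to a quotient algebra *)

Section Quotient.
Variables (k : fieldType) (R : algType k) (S : R -> Prop).
Variables (properS : ~ two_sided_ideal S 1) (V : lmodType k) (s : R -> V -> V).
Hypotheses (sV : unital_module s) (sS : forall u, S u -> forall v, s u v = 0).

Definition algquot_act (j : algquot properS) : V -> V := s (repr j).

(** The chosen representative differs from [u] by an element of the ideal, which acts as zero. *)
Lemma algquot_act_pi u : algquot_act (algquot_pi properS u) =1 s u.
Proof.
move=> v; apply/eqP; rewrite -subr_eq0 -(unital_moduleBl sV); apply/eqP.
by apply: (ideal_act_eq0 sV sS); apply/idealP; apply: algquot_repr.
Qed.

Lemma algquot_act_unital : unital_module algquot_act.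
Proof.
have piP j : exists u, j = algquot_pi properS u.
  by exists (repr j); rewrite /algquot_pi reprK.
split=> [|v]; last first.
  by rewrite -(rmorph1 (algquot_pi properS)) algquot_act_pi (unital_module1 sV).
split=> [v c j1 j2|j|j1 j2 v].
- have [[u1 ->] [u2 ->]] := (piP j1, piP j2).
  by rewrite -linearP !algquot_act_pi (unital_module_linearl sV).
- exact: (unital_module_linearr sV (repr j)).
- have [[u1 ->] [u2 ->]] := (piP j1, piP j2).
  by rewrite -rmorphM !algquot_act_pi (unital_moduleM sV).
Qed.

End Quotient.

(** * Images of relators under algebra morphisms *)

Lemma horner_alg_rmorph (k : fieldType) (A B : algType k)
    (g : {lrmorphism A -> B}) x q :
  horner_alg (g x) q = g (horner_alg x q).
Proof.
elim/poly_ind: q => [|q c IHq]; first by rewrite !raddf0.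
by rewrite !rmorphD !rmorphM /= IHq !horner_algX !horner_algC linearZ /= rmorph1.
Qed.

Lemma rmorph_horner_relator (k : fieldType) (A B : algType k)
    (g : {lrmorphism A -> B}) x y (q r : {poly k}) :
  g (horner_alg x q * y - y * horner_alg x q - y * horner_alg x r * y
     - y * horner_alg x r) =
  horner_alg (g x) q * g y - g y * horner_alg (g x) q
  - g y * horner_alg (g x) r * g y - g y * horner_alg (g x) r.
Proof. by rewrite !rmorphB !rmorphM /= !horner_alg_rmorph. Qed.

(** The left-hand side is the image of [RB_relator P f] under the projection [Jpi P]. *)
Lemma J_relator (k : fieldType) (P : {linear xpoly k -> xpoly k}) (f : xpoly k) :
  let ev (g : xpoly k) := horner_alg (jX P) (g : {poly k}) in
  ev (P f) * jY P - jY P * ev (P f) - jY P * ev f * jY P - jY P * ev f = 0.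
Proof.
rewrite /= -[LHS](rmorph_horner_relator (Jpi P)) -(raddf0 (Jpi P)).
apply/algquot_eqP; rewrite subr0.
by apply/idealP; apply: Ideal_gen; exists f.
Qed.

Theorem proposition3p2 (k : closedFieldType) (char0 : [pchar k] =i pred0)
    (P : {linear xpoly k -> xpoly k})
    (hP : forall n : nat, P (xpow k n) = - xpow k n) :
  (forall (M : vectType k) (s : Jalg P -> M -> M),
     unital_module s ->
     RB_module P (through_x s) (fun v : M => s (jY P) v)) /\
  (forall (M : vectType k) (act : xpoly k -> M -> M) (p : M -> M),
     RB_module P act p ->
     exists s : Jalg P -> M -> M,
       [/\ unital_module s,
           forall (f : xpoly k) (v : M), through_x s f v = act f v
         & forall v : M, s (jY P) v = p v]).
Proof.
split=> [M s sM | M act p RBM].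
  split=> [||f v].
  - exact: (horner_alg_xpoly_module sM (jX P)).
  - exact: (unital_module_linearr sM (jY P)).
  (* The difference of the two sides is the action of a relator, which is zero in the quotient. *)
  - apply/eqP; rewrite -subr_eq0; apply/eqP.
    have <- := horner_relator_act sM (act := through_x s) (x := jX P)
                 (fun f v => erefl) (fun v => erefl) (P f) f v.
    by rewrite J_relator (unital_module0l sM).
have actM := RB_module_action RBM.
(* Let the free generators act by x and by [p]. *)
have [F [FM FX FY]] :=
  free_moduleP (action_linearr actM (xpow k 0)) (RB_module_linear RBM).
(* Agreement on x extends to all of x k[x]. *)
have {}FX := xpoly_module_horner FM actM FX.
have F0 u : RB_relators P u -> forall v, F u v = 0.
  move=> [f ->] v; rewrite [LHS](horner_relator_act FM FX FY).
  by apply/eqP; rewrite subr_eq0 (RB_moduleE RBM).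
exists (algquot_act (properS := @RB_proper k P) F); split=> [|f v|v].
- exact: algquot_act_unital.
(* Evaluation at [jX P] is the projection of evaluation at [freeX], so the action can be computed
   upstairs. *)
- rewrite /through_x [horner_alg _ _](horner_alg_rmorph (Jpi P)).
  by rewrite -FX; apply: algquot_act_pi.
- by rewrite -FY; apply: algquot_act_pi.
Qed.
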